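(* There is a constant $c>0$ such that for all sufficiently large $n$, the Boolean lattice $2^{[n]}$ has at least $2^{c\,2^{n}\log n/\sqrt{n}}$ different partitions into $\binom{n}{\lfloor n/2\rfloor}$ symmetric chains.
   Context: $2^{[n]}$ is the power set of $[n]=\{1,\dots,n\}$ ordered by inclusion. A chain $c_0\subset\dots\subset c_k$ in $2^{[n]}$ is symmetric if $|c_i|=(n-k)/2+i$ for $i=0,\dots,k$ (equivalently, it is skipless and satisfies $|c_i|+|c_{k-i}|=n$). *)

(* Defs.v *)
From mathcomp Require Import all_boot.

Set Implicit Arguments.
Unset Strict Implicit.
Unset Printing Implicit Defensive.

(* The ground set [n] is represented by 'I_n, and 2^[n] by {set 'I_n}; a chain
   is identified with the set of its members.  The size condition
   |c_i| = (n - k)/2 + i is multiplied by 2 to avoid truncated subtraction and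
   division: it forces k <= n and n - k even, so bounding k by n in the
   quantifier loses nothing. *)
Definition symmetric_chain (n : nat) (C : {set {set 'I_n}}) : bool :=
  [exists k : 'I_n.+1, [exists c : {ffun 'I_k.+1 -> {set 'I_n}},
    [&& C == [set c i | i : 'I_k.+1],
        [forall i : 'I_k.+1, [forall j : 'I_k.+1,
          (i < j) ==> (c i \proper c j)]] &
        [forall i : 'I_k.+1, 2 * #|c i| + k == n + 2 * i]]]].

Definition symmetric_chain_partition (n : nat) (P : {set {set {set 'I_n}}}) :
    bool :=
  partition P [set: {set 'I_n}] && [forall C in P, symmetric_chain C].

Definition symmetric_chain_partitions (n m : nat) :
    {set {set {set {set 'I_n}}}} :=
  [set P | symmetric_chain_partition P && (#|P| == m)].

(* Main.v *)
(** Split [n] into two halves A and B, and take symmetric chain partitions of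
    2^A and 2^B.  Then 2^[n] is partitioned into grids, the products of a chain
    of s + 1 sets with a chain of t + 1 sets.  With m = min(s, t), such a grid has a
    symmetric chain partition for every permutation q of {0..m}: its chains,
    labelled by r = 0..m, run from rank r to rank s + t - r, and on each rank the
    chains present there are placed from left to right in increasing order of q.
    On rank m all chains are present, so q can be read off the partition, and
    2^[n] has at least P = prod_p (m_p + 1)! symmetric chain partitions, p ranging
    over the pairs of chains.  Since m! T^T >= T^m and the m_p + 1 add up to the
    number of chains 'C(n, n/2), P >= T^('C(n, n/2) - T #pairs).  The number of
    pairs is 'C(a, a/2) 'C(b, b/2) = O(2^n / n) with a, b the sizes of A and B,
    whereas 'C(n, n/2) is of order 2^n / sqrt n; hence for T a small power of n
    the exponent is at least 'C(n, n/2) / 2. *)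

Require Import Defs.
From mathcomp Require Import all_classical all_reals all_analysis.
From mathcomp Require Import all_boot all_order all_algebra all_fingroup zify ring lra.

Set Implicit Arguments.
Unset Strict Implicit.
Unset Printing Implicit Defensive.

Import Order.TTheory GRing.Theory Num.Theory.

(** * Grids *)

(** The position, counted from 0, of chain [r] when chains [0..x] are sorted by [q]. *)
Definition before (q : nat -> nat) (x r : nat) : nat :=
  \sum_(j < x.+1) (q j < q r).

Lemma before_lt q x r r' : r <= x -> q r < q r' -> before q x r < before q x r'.
Proof.
move=> rx qrr'; rewrite /before.
rewrite (bigD1 (Ordinal (rx : r < x.+1))) //=.
rewrite [X in _ < X](bigD1 (Ordinal (rx : r < x.+1))) //=.
rewrite ltnn qrr' add0n add1n ltnS; apply: leq_sum => j _.
by case: ltnP => // /ltn_trans/(_ qrr') ->.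
Qed.

Lemma before_le q x r : r <= x -> before q x r <= x.
Proof.
move=> rx; rewrite /before (bigD1 (Ordinal (rx : r < x.+1))) //= ltnn add0n.
apply: leq_trans (_ : \sum_(j < x.+1 | j != Ordinal (rx : r < x.+1)) 1 <= x).
  by apply: leq_sum => j _; case: ltnP.
by rewrite sum1_card cardC1 card_ord.
Qed.

Lemma before_inj q x r r' : {in [pred i | i <= x] &, injective q} ->
  r <= x -> r' <= x -> before q x r = before q x r' -> r = r'.
Proof.
move=> qI rx r'x e; apply: qI => //; case: (ltngtP (q r) (q r')) => // lt_q.
  by have := before_lt rx lt_q; rewrite e ltnn.
by have := before_lt r'x lt_q; rewrite e ltnn.
Qed.

Lemma before_onto q x y : {in [pred i | i <= x] &, injective q} ->
  y <= x -> exists2 r, r <= x & before q x r = y.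
Proof.
move=> qI yx; pose f (r : 'I_x.+1) : 'I_x.+1 := inord (before q x r).
have fI : injective f.
  move=> r r' /(congr1 val); rewrite /= !inordK ?ltnS ?before_le ?leq_ord //.
  by move/(before_inj qI) => e; apply/val_inj/e; apply: leq_ord.
have [g _ gK] := injF_bij fI.
exists (g (inord y)); first exact: leq_ord.
by have /(congr1 val) := gK (inord y); rewrite /= !inordK // ltnS before_le // leq_ord.
Qed.

(** A permutation takes every value below [s r] exactly once, so with all chains present the
    positions are the permutation itself. *)
Lemma before_perm m (s : {perm 'I_m.+1}) (r : 'I_m.+1) :
  before (fun j => s (inord j)) m r = s r.
Proof.
rewrite /before (eq_bigr (fun j => (s j < s r) : nat)) => [|j _]; last first.
  by rewrite !inord_val.
have -> : \sum_(j < m.+1) (s j < s r) = \sum_(j < m.+1) (j < s r).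
  by rewrite [RHS](reindex_perm s).
rewrite -(big_mkord xpredT (fun j => (j < s r) : nat)).
rewrite (big_cat_nat (n := s r)) //=; last exact: ltnW.
rewrite big_nat_cond (eq_bigr (fun=> 1)) => [|j]; last by case/andP => /andP[_ ->].
rewrite -big_nat_cond sum_nat_const_nat big1_seq => [|j]; first by lia.
by rewrite mem_index_iota /= => /andP[h _]; rewrite ltnNge h.
Qed.

(* The chains present on rank rho are those with label at most this bound. *)
Definition grid_level s t rho := minn (minn rho (s + t - rho)) (minn s t).

(* First coordinate of chain r on rank rho; the points of this rank have first
   coordinates starting at rho - t (truncated). *)
Definition grid_pos q s t r rho := rho - t + before q (grid_level s t rho) r.

Lemma grid_pos_bound q s t r rho : r <= grid_level s t rho -> rho <= s + t ->
  let u := grid_pos q s t r rho in [/\ u <= s, u <= rho & rho - u <= t].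
Proof.
move=> /(before_le q) + rl; rewrite /grid_pos /grid_level /=.
by set b := before _ _ _; clearbody b => h; split; lia.
Qed.

Lemma before_recr q x r : before q x.+1 r = before q x r + (q x.+1 < q r).
Proof. by rewrite /before big_ord_recr. Qed.

(** This makes the chains nested and skipless: from one rank to the next, exactly one of the two
    coordinates grows, by one. *)
Lemma grid_pos_step q s t r rho : rho < s + t ->
  grid_pos q s t r rho <= grid_pos q s t r rho.+1 <= (grid_pos q s t r rho).+1.
Proof.
move=> h; rewrite /grid_pos; set x := grid_level _ _ rho; set y := grid_level _ _ rho.+1.
(* Below rank [minn s t] a new chain joins; up to [maxn s t] the same chains stay; beyond it the
   last chain ends while the left end of the rank moves by one. *)
have : [\/ [/\ y = x.+1, rho.+1 - t = 0 & rho - t = 0],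
          y = x | x = y.+1 /\ rho.+1 - t = (rho - t).+1].
  rewrite /x /y /grid_level.
  have [h1|h1] := ltnP rho (minn s t); first by constructor 1; split; lia.
  have [h2|h2] := ltnP rho (maxn s t); first by constructor 2; lia.
  by constructor 3; split; lia.
case=> [[-> -> ->]|->|[-> ->]]; rewrite ?before_recr; lia.
Qed.

Lemma grid_pos_inj q s t r r' rho :
  {in [pred i | i <= minn s t] &, injective q} ->
  r <= grid_level s t rho -> r' <= grid_level s t rho ->
  grid_pos q s t r rho = grid_pos q s t r' rho -> r = r'.
Proof.
move=> qI rx r'x /addnI; apply: before_inj => // i j; rewrite !inE => ix jx.
by apply: qI; rewrite inE; move: ix jx; rewrite /grid_level; lia.
Qed.

Lemma grid_pos_onto q s t i j :
  {in [pred i | i <= minn s t] &, injective q} -> i <= s -> j <= t ->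
  exists2 r, r <= grid_level s t (i + j) & grid_pos q s t r (i + j) = i.
Proof.
move=> qI iS jt.
have [||r rx e] := @before_onto q (grid_level s t (i + j)) (i - (i + j - t)).
- by move=> a b; rewrite !inE => ax bx; apply: qI; rewrite inE;
    move: ax bx; rewrite /grid_level; lia.
- by rewrite /grid_level; lia.
by exists r => //; rewrite /grid_pos e; lia.
Qed.

(** * Labelled symmetric chain partitions of a power set *)

(* The chain of label l is c l 0, .., c l (k l); the values c l i with i > k l are
   irrelevant. *)
Record scd (T : finType) (A : {set T}) (L : finType) (k : L -> nat)
    (c : L -> nat -> {set T}) : Prop := Scd {
  scd_sub : forall l i, i <= k l -> c l i \subset A;
  scd_step : forall l i, i < k l -> c l i \subset c l i.+1;
  scd_card : forall l i, i <= k l -> 2 * #|c l i| + k l = #|A| + 2 * i;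
  scd_onto : forall X : {set T}, X \subset A -> exists l, exists2 i, i <= k l & c l i = X;
  scd_inj : forall l l' i i', i <= k l -> i' <= k l' -> c l i = c l' i' -> l = l'
}.

Lemma scd_inj2 (T : finType) (A : {set T}) (L : finType) k (c : L -> nat -> {set T})
    l l' i i' : scd A k c -> i <= k l -> i' <= k l' -> c l i = c l' i' ->
  l = l' /\ i = i'.
Proof.
move=> S hi hi' e; have ll' := scd_inj S hi hi' e; split=> //; subst l'.
by have := scd_card S hi; have := scd_card S hi'; rewrite e; lia.
Qed.

Lemma scd_mono (T : finType) (A : {set T}) (L : finType) k (c : L -> nat -> {set T})
    l i j : scd A k c -> i <= j -> j <= k l -> c l i \subset c l j.
Proof.
move=> S /subnK <-; elim: (j - i) => // d IH h.
by apply: subset_trans (IH _) (scd_step S _); rewrite // ltnW.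
Qed.

Lemma scd_proper (T : finType) (A : {set T}) (L : finType) k (c : L -> nat -> {set T})
    l i j : scd A k c -> i < j -> j <= k l -> c l i \proper c l j.
Proof.
move=> S ij jk; rewrite properEcard (scd_mono S) ?(ltnW ij) //=.
by have := scd_card S jk; have := scd_card S (leq_trans (ltnW ij) jk); lia.
Qed.

Lemma scd_labels (T : finType) (A : {set T}) (L : finType) k (c : L -> nat -> {set T}) :
  scd A k c -> #|L| = 'C(#|A|, #|A|./2).
Proof.
move=> S; rewrite -(cards_draws A). (* each chain has one member on the middle level *)
have half l : (k l)./2 <= k l by lia.
rewrite -(card_imset predT (f := fun l => c l (k l)./2)); last first.
  by move=> l l' e; apply: (scd_inj S _ _ e).
apply: eq_card => X; rewrite inE; apply/imsetP/andP => [[l _ ->]|[XA /eqP cX]].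
  split; first exact: (scd_sub S (half l)).
  by apply/eqP; have := scd_card S (half l); lia.
have [l [i il e]] := scd_onto S XA; exists l => //.
by rewrite -e; congr c; have := scd_card S il; rewrite e; lia.
Qed.

Definition scd_blocks (T : finType) (L : finType) (k : L -> nat)
    (c : L -> nat -> {set T}) : {set {set {set T}}} :=
  [set [set c l i | i : 'I_(k l).+1] | l : L].

Lemma card_scd_block (T : finType) (A : {set T}) (L : finType) k
    (c : L -> nat -> {set T}) l :
  scd A k c -> #|[set c l i | i : 'I_(k l).+1]| = (k l).+1.
Proof.
move=> S; rewrite card_imset ?card_ord // => i j /(scd_inj2 S) e.
by have [||_ /val_inj] := e; rewrite ?leq_ord.
Qed.

Lemma scd_blocksP n (L : finType) k (c : L -> nat -> {set 'I_n}) :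
  scd setT k c -> scd_blocks k c \in symmetric_chain_partitions n 'C(n, n./2).
Proof.
move=> S; have lek l (i : 'I_(k l).+1) : i <= k l by rewrite -ltnS.
rewrite inE; apply/andP; split; last first.
  have := scd_labels S; rewrite cardsT card_ord => <-; rewrite card_imset // => l l' e.
  have : c l 0 \in [set c l' i | i : 'I_(k l').+1].
    by rewrite -e; apply/imsetP; exists ord0.
  by case/imsetP => i _ /(scd_inj S); apply.
apply/andP; split; last first.
  apply/forallP => C; apply/implyP => /imsetP[l _ ->].
  have kn : k l < n.+1.
    have := scd_card S (leq0n (k l)); have := scd_card S (leqnn (k l)).
    by have := max_card (mem (c l (k l))); rewrite cardsT !card_ord; lia.
  apply/existsP; exists (Ordinal kn); apply/existsP.
  exists [ffun i : 'I_(Ordinal kn).+1 => c l i]; apply/and3P; split.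
  - by apply/eqP/eq_imset => i; rewrite ffunE.
  - apply/forallP => i; apply/forallP => j; apply/implyP => ij.
    by rewrite !ffunE; apply: (scd_proper S _ (lek _ _)).
  apply/forallP => i; rewrite ffunE.
  by have := scd_card S (lek l i); rewrite cardsT card_ord => /eqP.
apply/and3P; split.
- apply/eqP/setP => X; rewrite inE; apply/bigcupP.
  have [l [i il <-]] := scd_onto S (subsetT X).
  exists [set c l i | i : 'I_(k l).+1]; first exact: imset_f.
  by apply/imsetP; exists (Ordinal (il : i < (k l).+1)).
- apply/trivIsetP => _ _ /imsetP[l _ ->] /imsetP[l' _ ->] ne.
  rewrite -setI_eq0; apply: contraNT ne => /set0Pn[X /setIP[]].
  by move=> /imsetP[i _ ->] /imsetP[i' _ /(scd_inj S) ->].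
apply/negP => /imsetP[l _ /setP/(_ (c l 0))].
by rewrite inE => /esym/imsetP[]; exists ord0.
Qed.

(** * Products of labelled partitions *)

Definition prod_min (L1 L2 : finType) (k1 : L1 -> nat) (k2 : L2 -> nat)
    (p : L1 * L2) : nat := minn (k1 p.1) (k2 p.2).

Definition prod_label (L1 L2 : finType) (k1 : L1 -> nat) (k2 : L2 -> nat) : finType :=
  {p : L1 * L2 & 'I_(prod_min k1 k2 p).+1}.

Definition prod_len (L1 L2 : finType) (k1 : L1 -> nat) (k2 : L2 -> nat)
    (l : prod_label k1 k2) : nat :=
  k1 (tag l).1 + k2 (tag l).2 - 2 * tagged l.

(** Chain [r] of a grid starts at rank [r], so its member [i] lies on rank [r + i], at the grid
    point [(u, rho - u)]. *)
Definition prod_chain (T L1 L2 : finType) (k1 : L1 -> nat) (k2 : L2 -> nat)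
    (c1 : L1 -> nat -> {set T}) (c2 : L2 -> nat -> {set T})
    (q : L1 * L2 -> nat -> nat) (l : prod_label k1 k2) (i : nat) : {set T} :=
  let rho := tagged l + i in
  let u := grid_pos (q (tag l)) (k1 (tag l).1) (k2 (tag l).2) (tagged l) rho in
  c1 (tag l).1 u :|: c2 (tag l).2 (rho - u).

Lemma prod_level (L1 L2 : finType) (k1 : L1 -> nat) (k2 : L2 -> nat)
    (l : prod_label k1 k2) i : i <= prod_len l ->
  tagged l <= grid_level (k1 (tag l).1) (k2 (tag l).2) (tagged l + i) /\
  tagged l + i <= k1 (tag l).1 + k2 (tag l).2.
Proof.
case: l => -[l1 l2] r; rewrite /prod_len /grid_level /=.
by have := ltn_ord r; rewrite /prod_min /=; lia.
Qed.

Lemma setIUl_disj (T : finType) (A B X Y : {set T}) : [disjoint A & B] ->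
  X \subset A -> Y \subset B -> (X :|: Y) :&: A = X.
Proof.
move=> dAB XA YB; rewrite setIUl (setIidPl XA).
suff -> : Y :&: A = set0 by rewrite setU0.
by apply/disjoint_setI0; rewrite disjoint_sym; apply: disjointWr YB dAB.
Qed.

Lemma setIUr_disj (T : finType) (A B X Y : {set T}) : [disjoint A & B] ->
  X \subset A -> Y \subset B -> (X :|: Y) :&: B = Y.
Proof. by rewrite disjoint_sym setUC => dAB XA YB; apply: setIUl_disj dAB _ _. Qed.

(** Intersecting with [A] and with [B] recovers the two factors, hence the grid and both
    coordinates. Two orders [q], [q'] are allowed so that different partitions can be compared. *)
Lemma prod_chain_eq (T : finType) (A B : {set T}) (L1 L2 : finType) k1 k2
    (c1 : L1 -> nat -> {set T}) (c2 : L2 -> nat -> {set T}) q q'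
    (l l' : prod_label k1 k2) i i' :
  scd A k1 c1 -> scd B k2 c2 -> [disjoint A & B] ->
  i <= prod_len l -> i' <= prod_len l' ->
  prod_chain c1 c2 q l i = prod_chain c1 c2 q' l' i' ->
  [/\ tag l = tag l', tagged l + i = tagged l' + i' &
   grid_pos (q (tag l)) (k1 (tag l).1) (k2 (tag l).2) (tagged l) (tagged l + i) =
   grid_pos (q' (tag l')) (k1 (tag l').1) (k2 (tag l').2) (tagged l') (tagged l' + i')].
Proof.
move=> S1 S2 dAB /prod_level[h1 h2] /prod_level[h1' h2'].
have [] := grid_pos_bound (q (tag l)) h1 h2.
have [] := grid_pos_bound (q' (tag l')) h1' h2'.
rewrite /prod_chain; set u := grid_pos _ _ _ _ _; set u' := grid_pos _ _ _ _ _.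
move=> us ur ut us' ur' ut' e.
have /(scd_inj2 S1)[]// : c1 (tag l).1 u' = c1 (tag l').1 u.
  have /(congr1 (fun X => X :&: A)) := e.
  by rewrite !(setIUl_disj dAB) ?(scd_sub S1) ?(scd_sub S2).
have /(scd_inj2 S2)[]// :
    c2 (tag l).2 (tagged l + i - u') = c2 (tag l').2 (tagged l' + i' - u).
  have /(congr1 (fun X => X :&: B)) := e.
  by rewrite !(setIUr_disj dAB) ?(scd_sub S1) ?(scd_sub S2).
move=> e2 ev e1 eu; split=> //; last by lia.
by rewrite [tag l]surjective_pairing [tag l']surjective_pairing e1 e2.
Qed.

(** On each rank of a grid, [grid_pos] matches the chains present with the points of that rank
    bijectively, which gives covering and disjointness. *)
Lemma prod_scd (T : finType) (A B : {set T}) (L1 L2 : finType) k1 k2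
    (c1 : L1 -> nat -> {set T}) (c2 : L2 -> nat -> {set T}) q :
  scd A k1 c1 -> scd B k2 c2 -> [disjoint A & B] ->
  (forall p, {in [pred i | i <= prod_min k1 k2 p] &, injective (q p)}) ->
  scd (A :|: B) (@prod_len L1 L2 k1 k2) (prod_chain c1 c2 q).
Proof.
move=> S1 S2 dAB qI; split.
- move=> l i /prod_level[h1 h2]; have [us _ ut] := grid_pos_bound (q (tag l)) h1 h2.
  by apply: setUSS; [apply: (scd_sub S1 us)|apply: (scd_sub S2 ut)].
- move=> l i il; have [h1 h2] := prod_level (ltnW il).
  have [h1' h2'] := prod_level il.
  have [us ur ut] := grid_pos_bound (q (tag l)) h1 h2.
  have [us' ur' ut'] := grid_pos_bound (q (tag l)) h1' h2'.
  rewrite /prod_chain; move: h2' us' ur' ut'; rewrite addnS => h2' us' ur' ut'.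
  have /andP[a b] := grid_pos_step (q (tag l)) (tagged l) h2'.
  by apply: setUSS; [apply: (scd_mono S1 _ _)|apply: (scd_mono S2 _ _)] => //; lia.
- move=> l i il; have [h1 h2] := prod_level il.
  have [us ur ut] := grid_pos_bound (q (tag l)) h1 h2.
  have := scd_card S1 us; have := scd_card S2 ut; rewrite /prod_chain.
  have dj : [disjoint c1 (tag l).1 (grid_pos (q (tag l)) (k1 (tag l).1) (k2 (tag l).2)
      (tagged l) (tagged l + i)) & c2 (tag l).2 (tagged l + i - grid_pos (q (tag l))
      (k1 (tag l).1) (k2 (tag l).2) (tagged l) (tagged l + i))].
    by apply: disjointW dAB; [apply: (scd_sub S1 us)|apply: (scd_sub S2 ut)].
  rewrite !cardsU (disjoint_setI0 dAB) (disjoint_setI0 dj) cards0 /prod_len.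
  by move: h1; rewrite /grid_level; lia.
- move=> X /setIidPl XAB.
  have [l1 [i1 i1k e1]] := scd_onto S1 (subsetIr X A).
  have [l2 [i2 i2k e2]] := scd_onto S2 (subsetIr X B).
  have [r rx e] := grid_pos_onto (qI (l1, l2)) i1k i2k.
  have rm : r < (prod_min k1 k2 (l1, l2)).+1.
    by move: rx; rewrite /grid_level /prod_min /=; lia.
  exists (Tagged (fun p => 'I_(prod_min k1 k2 p).+1) (Ordinal rm)).
  have rE : r + (i1 + i2 - r) = i1 + i2 by move: rx; rewrite /grid_level; lia.
  exists (i1 + i2 - r).
    by move: rx; rewrite /prod_len /grid_level /=; lia.
  by rewrite /prod_chain /= rE e addKn e1 e2 -setIUr XAB.
- move=> l l' i i' il il' /(prod_chain_eq S1 S2 dAB il il')[].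
  have [h1 _] := prod_level il; have [h1' _] := prod_level il'.
  case: l l' il il' h1 h1' => [p r] [p' r'] /= _ _ h1 h1' ep er.
  subst p'; rewrite er in h1 *; move/(grid_pos_inj (qI p) h1 h1')/val_inj => ->.
  by [].
Qed.

(** Induction on [#|A|]: remove a point [x] and multiply a partition for [A :\ x] by the single
    chain from [set0] to [[set x]]. *)
Lemma scd_exists (T : finType) (A : {set T}) :
  exists (L : finType) (k : L -> nat) (c : L -> nat -> {set T}), scd A k c.
Proof.
have [n] := ubnP #|A|; elim: n A => // n IH A; rewrite ltnS => An.
have [->|[x xA]] := set_0Vmem A.
  exists unit, (fun=> 0), (fun _ _ => set0); split => //.
  - by move=> ? [|] // _; rewrite cards0.
  - by move=> X; rewrite subset0 => /eqP ->; exists tt, 0.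
  - by move=> [] [].
have S1 : scd [set x] (fun _ : unit => 1) (fun _ i => if i is 0 then set0 else [set x]).
  split => //.
  - by move=> _ [|i] _ //; apply: sub0set.
  - by move=> _ [|i] _; [apply: sub0set|].
  - by move=> _ [|[|i]] // _; rewrite ?cards0 ?cards1.
  - by move=> X; rewrite subset1 => /orP[] /eqP ->; exists tt; [exists 1|exists 0].
  - by move=> [] [].
have [|L2 [k2 [c2 S2]]] := IH (A :\ x).
  by move: An; rewrite (cardsD1 x) xA.
rewrite -(setD1K xA).
have dis : [disjoint [set x] & A :\ x] by rewrite disjoints1 !inE eqxx.
have S := prod_scd S1 S2 dis (q := fun _ => id) (fun _ _ _ _ _ => id).
by do 3 eexists; exact: S.
Qed.

Definition perm_order (L1 L2 : finType) (k1 : L1 -> nat) (k2 : L2 -> nat)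
    (s : {dffun forall p : L1 * L2, {perm 'I_(prod_min k1 k2 p).+1}})
    (p : L1 * L2) (j : nat) : nat := s p (inord j).

Lemma perm_order_inj (L1 L2 : finType) (k1 : L1 -> nat) (k2 : L2 -> nat)
    (s : {dffun forall p : L1 * L2, {perm 'I_(prod_min k1 k2 p).+1}}) p :
  {in [pred i | i <= prod_min k1 k2 p] &, injective (perm_order s p)}.
Proof.
move=> i j ip jp /val_inj/perm_inj/(congr1 val) /=.
by rewrite !inordK.
Qed.

(** The permutation of each grid is read off its rank [m], where every chain is present and
    positions start at 0. *)
Lemma prod_blocks_inj (T : finType) (A B : {set T}) (L1 L2 : finType) k1 k2
    (c1 : L1 -> nat -> {set T}) (c2 : L2 -> nat -> {set T}) :
  scd A k1 c1 -> scd B k2 c2 -> [disjoint A & B] ->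
  injective (fun s => scd_blocks (@prod_len L1 L2 k1 k2)
                        (prod_chain c1 c2 (@perm_order L1 L2 k1 k2 s))).
Proof.
move=> S1 S2 dAB s s' e; apply/ffunP => p; apply/permP => r; apply/val_inj.
have S q := prod_scd S1 S2 dAB (@perm_order_inj L1 L2 k1 k2 q).
pose l : prod_label k1 k2 := Tagged (fun p => 'I_(prod_min k1 k2 p).+1) r.
set m := prod_min k1 k2 p in r l *.
have rm : r <= m by rewrite -ltnS.
(* Chain [r] reaches rank [m] at index [m - r]. *)
have il : m - r <= prod_len l by rewrite /prod_len /= /m /prod_min; lia.
have : [set prod_chain c1 c2 (perm_order s) l i | i : 'I_(prod_len l).+1] \in
    scd_blocks (@prod_len L1 L2 k1 k2) (prod_chain c1 c2 (perm_order s')).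
  by rewrite -e; apply: imset_f.
case/imsetP => l' _ eC.
have lenE : prod_len l = prod_len l'.
  apply: succn_inj; rewrite -(card_scd_block l (S s)) -(card_scd_block l' (S s')).
  by rewrite eC.
have : prod_chain c1 c2 (perm_order s) l (m - r) \in
   [set prod_chain c1 c2 (perm_order s') l' i | i : 'I_(prod_len l').+1].
  by rewrite -eC; apply/imsetP; exists (Ordinal (il : m - r < (prod_len l).+1)).
case/imsetP => i' _ /(prod_chain_eq S1 S2 dAB il) []; first by rewrite -ltnS.
have [] : grid_level (k1 p.1) (k2 p.2) m = m /\ m - k2 p.2 = 0.
  by rewrite /grid_level /m /prod_min; split; lia.
case: l' lenE {eC} i' => p' r' /= lenE i' lvl mt ep er; subst p'.
rewrite -er /= subnKC // /grid_pos lvl mt !add0n.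
(* Within one grid the length of a chain determines its label. *)
have -> : r' = r.
  apply/val_inj; move: lenE rm (ltn_ord r') => /=; rewrite /prod_len /= /m /prod_min; lia.
by rewrite /perm_order !before_perm.
Qed.

(** * Estimates *)

(** For [m <= T] the factor [T ^ T] suffices alone; beyond [T], each new factor of the factorial
    exceeds [T]. *)
Lemma expn_le_fact T m : 0 < T -> T ^ m <= m`! * T ^ T.
Proof.
move=> T0; have [mT|/ltnW] := leqP m T.
  by apply: leq_trans (leq_pmull _ (fact_gt0 m)); rewrite leq_pexp2l.
elim: m => [|m IH]; first by rewrite leqn0 => /eqP->.
rewrite leq_eqVlt => /orP[/eqP ->|Tm]; first by rewrite leq_pmull ?fact_gt0.
by rewrite expnS factS -mulnA leq_mul ?IH // ltnW.
Qed.

Lemma expn_le_prod_fact (I : finType) (m : I -> nat) T : 0 < T ->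
  T ^ (\sum_i m i) <= \prod_i (m i)`! * T ^ (T * #|I|).
Proof.
move=> T0; rewrite mulnC expnM -prod_nat_const -big_split /= expn_sum.
apply: leq_prod => i _; rewrite mulnC; exact: expn_le_fact.
Qed.

(** * Central binomial coefficients *)

Lemma bin_halves m : 'C(m.*2.+1, m.+1) = 'C(m.*2.+1, m).
Proof.
have -> : m.+1 = m.*2.+1 - m by lia.
by rewrite bin_sub //; lia.
Qed.

Lemma central_bin_rec m :
  'C(m.+1.*2, m.+1) * m.+1 = 'C(m.*2, m) * (2 * (2 * m + 1)).
Proof.
have := mul_bin_diag m.+1.*2 m; have := mul_bin_diag m.*2.+1 m.
rewrite bin_halves /=.
move: 'C(m.+1.*2, m.+1) 'C(m.*2, m) 'C(_, _) => x y z; lia.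
Qed.

Lemma odd_central_bin m : 'C(m.+1.*2, m.+1) = 2 * 'C(m.*2.+1, m).
Proof. by rewrite doubleS binS bin_halves mul2n addnn. Qed.

(** Induction step of both even bounds, with [x], [y] consecutive central coefficients and [z]
    standing for [4 ^ m.*2]. It rests on [(2m+1)(2m+3) <= 4(m+1)^2] and [4m(m+1) <= (2m+1)^2]. *)
Lemma central_bin_step m x y z : x * m.+1 = y * (2 * (2 * m + 1)) ->
  ((2 * m + 1) * y ^ 2 <= z -> (2 * m + 3) * x ^ 2 <= 16 * z) /\
  (z <= 4 * m * y ^ 2 -> 16 * z <= 4 * m.+1 * x ^ 2).
Proof.
move=> e.
have e2 : x ^ 2 * m.+1 ^ 2 = 4 * (2 * m + 1) ^ 2 * y ^ 2.
  by rewrite -expnMn e !expnMn; lia.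
split=> h; rewrite -(leq_pmul2r (m := m.+1 ^ 2)) ?expn_gt0 // -mulnA.
  rewrite e2; apply: leq_trans (_ : 4 * (2 * m + 3) * (2 * m + 1) * z <= _).
    by have := leq_mul (leqnn (4 * (2 * m + 3) * (2 * m + 1))) h; lia.
  by rewrite [16 * z * _]mulnAC leq_mul2r; apply/orP; right; lia.
rewrite -[_ * _ * m.+1 ^ 2]mulnA e2.
apply: leq_trans (_ : 64 * m * m.+1 ^ 2 * y ^ 2 <= _).
  by have := leq_mul (leqnn (16 * m.+1 ^ 2)) h; lia.
by rewrite mulnA leq_mul2r; apply/orP; right; lia.
Qed.

Lemma central_bin_even_ub m : (2 * m + 1) * 'C(m.*2, m) ^ 2 <= 4 ^ m.*2.
Proof.
elim: m => [|m IH]; first by rewrite bin0.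
have [/(_ IH) + _] := central_bin_step (4 ^ m.*2) (central_bin_rec m).
by rewrite doubleS !expnS; lia.
Qed.

Lemma central_bin_even_lb m : 0 < m -> 4 ^ m.*2 <= 4 * m * 'C(m.*2, m) ^ 2.
Proof.
elim: m => [//|[//|m] IH _].
have [_ /(_ (IH isT))] := central_bin_step (4 ^ m.+1.*2) (central_bin_rec m.+1).
by rewrite [m.+2.*2]doubleS !expnS; lia.
Qed.

(** Odd [n] reduces to [n + 1], whose central coefficient is exactly twice as large. *)
Lemma central_bin_ub n : n.+1 * 'C(n, n./2) ^ 2 <= 4 ^ n.
Proof.
move: (odd_double_half n); move: (n./2) (odd n) => m [] <-; rewrite ?add0n ?add1n.
  have := central_bin_even_ub m.+1.
  by rewrite odd_central_bin doubleS !expnMn !expnS; lia.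
by have := central_bin_even_ub m; lia.
Qed.

Lemma central_bin_lb n : 0 < n -> 4 ^ n <= 2 * n.+1 * 'C(n, n./2) ^ 2.
Proof.
move: (odd_double_half n); move: (n./2) (odd n) => m [] <-; rewrite ?add0n ?add1n => n0.
  have := central_bin_even_lb (ltn0Sn m).
  by rewrite odd_central_bin doubleS !expnMn !expnS; lia.
by have := @central_bin_even_lb m; lia.
Qed.

(** The upper bounds for the halves and the lower bound for the whole show that the number of grids
    is smaller than the number of chains by a factor of order [sqrt n]. *)
Lemma central_bin_split a b T : a <= b <= a.+1 -> 0 < b ->
  32 * T ^ 2 <= a + b ->
  'C(a + b, (a + b)./2) <=
    2 * ('C(a + b, (a + b)./2) - T * ('C(a, a./2) * 'C(b, b./2))).
Proof.
move=> hab b0; set n := a + b => Tn.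
have n0 : 0 < n by rewrite addn_gt0 b0 orbT.
have xyz : n.+1 * ('C(a, a./2) * 'C(b, b./2)) ^ 2 <= 8 * 'C(n, n./2) ^ 2.
  have := leq_mul (central_bin_ub a) (central_bin_ub b); rewrite -expnD -/n.
  move/leq_trans/(_ (central_bin_lb n0)).
  move: 'C(n, n./2) 'C(a, a./2) 'C(b, b./2) => x y z h.
  have h2 : n.+1 ^ 2 <= 4 * (a.+1 * b.+1).
    rewrite /n; have [->|->] : b = a \/ b = a.+1 by lia.
      by lia.
    by lia.
  rewrite -(leq_pmul2l (ltn0Sn n)) mulnA mulnn.
  have := leq_mul h2 (leqnn ((y * z) ^ 2)).
  by move/leq_trans; apply; rewrite expnMn; lia.
move: 'C(n, n./2) ('C(a, a./2) * 'C(b, b./2)) xyz => x w xw.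
suff : 2 * (T * w) <= x by lia.
rewrite -leq_sqr -(leq_pmul2l (ltn0Sn n)) !expnMn.
by have := leq_mul Tn (leqnn (x ^ 2)); have := leq_mul (leqnn (T ^ 2)) xw; lia.
Qed.

(** * Counting partitions *)

Lemma foldr_muln_codom (I : finType) (F : I -> nat) :
  foldr muln 1 [seq F i | i : I] = \prod_i F i.
Proof. by rewrite foldrE big_map big_enum. Qed.

(** Here [I] is the set of grids and [m p] the number of chains in grid [p]; the sum counts all
    chains grid by grid. *)
Lemma leq_card_symmetric_chain_partitions a b :
  exists (I : finType) (m : I -> nat),
  [/\ \sum_i m i = 'C(a + b, (a + b)./2), #|I| = 'C(a, a./2) * 'C(b, b./2) &
   \prod_i (m i)`! <= #|symmetric_chain_partitions (a + b) 'C(a + b, (a + b)./2)|].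
Proof.
pose A := [set lshift b i | i : 'I_a].
have cA : #|A| = a by rewrite card_imset ?card_ord //; apply: lshift_inj.
have cB : #|~: A| = b by have := cardsC A; rewrite cA card_ord; lia.
have dis : [disjoint A & ~: A] by rewrite -setI_eq0 setICr.
have [L1 [k1 [c1 S1]]] := scd_exists A.
have [L2 [k2 [c2 S2]]] := scd_exists (~: A).
have S q qI : scd [set: 'I_(a + b)] _ _ := eq_rect _ (fun X => scd X _ _)
  (prod_scd (q := q) S1 S2 dis qI) _ (setUCr A).
exists (L1 * L2)%type, (fun p => (prod_min k1 k2 p).+1); split.
- have := scd_labels (S (fun _ => id) (fun _ _ _ _ _ => id)).
  rewrite cardsT card_ord => <-; rewrite card_tagged sumnE big_map big_enum /=.
  by apply: eq_bigr => p _; rewrite card_ord.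
- by rewrite card_prod (scd_labels S1) (scd_labels S2) cA cB.
pose f s := scd_blocks (@prod_len L1 L2 k1 k2)
  (prod_chain c1 c2 (@perm_order L1 L2 k1 k2 s)).
apply: leq_trans (_ : #|[set f s | s in predT]| <= _).
  rewrite card_imset; last exact: prod_blocks_inj S1 S2 dis.
  rewrite card_dep_ffun foldr_muln_codom; apply/eq_leq/eq_bigr => p _.
  by rewrite card_Sn.
apply/subset_leq_card/subsetP => _ /imsetP[s _ ->].
exact: scd_blocksP (S _ (@perm_order_inj _ _ _ _ s)).
Qed.

Local Open Scope ring_scope.

Theorem theorem1p5 (R : realType) :
  exists2 c : R, 0 < c &
    exists N : nat, forall n : nat, (N <= n)%N ->
      2 `^ (c * 2 ^+ n * ln n%:R / Num.sqrt n%:R) <=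
      #|symmetric_chain_partitions n 'C(n, n./2)|%:R.
Proof.
(* The constant collects a factor 2 from [bn], 8 from [lnn] and 2 from [CD]. *)
exists (32%:R^-1) => //; exists (2 ^ 12)%N => n Nn.
have n0 : (0 < n)%N by apply: leq_trans Nn.
(* The threshold is [T = 2 ^ t], of order [n^(1/4)]; being a power of two, it gives
   [T ^ D = 2 ^ (t * D)]. *)
pose t := (trunc_log 2 n %/ 4)%N.
have L12 : (12 <= trunc_log 2 n)%N by apply: trunc_log_max.
have t3 : (3 <= t)%N by rewrite /t; lia.
have tn : (32 * (2 ^ t) ^ 2 <= n)%N.
  apply: leq_trans (@trunc_logP 2 n isT n0).
  by rewrite -expnM -[32%N]/(2 ^ 5)%N -expnD leq_exp2l // /t; lia.
have lnn : ln n%:R <= (8 * t)%:R :> R.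
  apply: le_trans (_ : ln (2 ^+ (8 * t)) <= _).
    rewrite ler_ln ?posrE ?ltr0n ?exprn_gt0 // -natrX ler_nat.
    apply: leq_trans (ltnW (trunc_log_ltn n (ltnSn 1))) _.
    by rewrite leq_exp2l //; lia.
  rewrite lnXn // -[leRHS]mulr1 mulr_natl lerMn2r; apply/orP; right.
  by have := @le_ln1Dx R 1; rewrite -[1 + 1]/2; apply; lra.
have bn : 2 ^+ n / Num.sqrt n%:R <= 2 * 'C(n, n./2)%:R :> R.
  rewrite ler_pdivrMr ?sqrtr_gt0 ?ltr0n //.
  rewrite -ler_sqr ?nnegrE ?mulr_ge0 ?exprn_ge0 ?sqrtr_ge0 //.
  rewrite 2!exprMn sqr_sqrtr ?ler0n // -!natrX -!natrM ler_nat -expnM mulnC expnM.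
  apply: leq_trans (central_bin_lb n0) _.
  by rewrite [leqRHS]mulnAC leq_mul2r; apply/orP; right; lia.
pose a := n./2; pose b := (n - n./2)%N.
have ab : (a + b = n)%N by rewrite /a /b; lia.
have [I [m [sum_m cI]]] := leq_card_symmetric_chain_partitions a b.
have hab : (a <= b <= a.+1)%N by rewrite /a /b; lia.
have b0 : (0 < b)%N by rewrite /b; lia.
have := @central_bin_split a b (2 ^ t) hab b0; rewrite -cI.
rewrite !ab in sum_m *; move=> /(_ tn).
set C := 'C(n, n./2) in bn sum_m *; set D := (C - _)%N => CD card_ge.
have C0 : (0 < C)%N by rewrite bin_gt0; lia.
have count : (2 ^ (t * D) <= #|symmetric_chain_partitions n C|)%N.
  apply: leq_trans card_ge.
  have T0 : (0 < 2 ^ t)%N by rewrite expn_gt0.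
  rewrite -(@leq_pmul2r ((2 ^ t) ^ (2 ^ t * #|I|))) ?expn_gt0 //.
  (* The subtraction in [D] is not truncated: [0 < C <= 2 * D] forces [D] to be positive. *)
  rewrite [(2 ^ (t * D))%N]expnM -expnD subnK; last by rewrite /D in CD; lia.
  by rewrite -sum_m; apply: expn_le_prod_fact.
apply: le_trans (_ : (2 ^ (t * D))%:R <= _); last by rewrite ler_nat.
rewrite natrX -[leRHS]powR_mulrn //; apply: ler_powR; first by rewrite ler1n.
apply: le_trans (_ : 32^-1 * ((2 * C%:R) * (8 * t)%:R) <= _).
  rewrite [leLHS](_ : _ = 32^-1 * (2 ^+ n / Num.sqrt n%:R * ln n%:R)); last by ring.
  rewrite ler_pM2l ?invr_gt0 //.
  by apply: ler_pM; rewrite ?divr_ge0 ?exprn_ge0 ?sqrtr_ge0 ?ln_ge0 ?ler1n.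
have : t%:R * C%:R <= t%:R * (2 * D%:R) :> R.
  by rewrite ler_wpM2l // -natrM ler_nat.
rewrite !natrM; lra.
Qed.
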